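(* Let $(S,d)$ be a separable metric space, let $(X_i)_{i\in\mathbb Z}=(X_0\circ T^i)_{i\in\mathbb Z}$ be a strictly stationary sequence taking values in $S$ and let $p\geq 1$. Suppose that the measurable function $h\colon S^2\to\mathbb R$ (not assumed symmetric) and $(X_0\circ T^i)_{i\in\mathbb Z}$ satisfy the following assumptions: (1) the collection $\{|h(X_i,X_j)|^p : 1\leq i<j\}$ is uniformly integrable; (2) for almost every $\omega\in\Omega$, $I_2(S,\mathbf 1_{D(h)},\omega)=0$, where $D(h)\subset S^2$ denotes the set of discontinuity points of $h$; (3) the integral $\int_\Omega\int_{S^2}|h(x,y)|^p\,d\mu_\omega(x)\,d\mu_\omega(y)\,d\mathbb P(\omega)$ is finite. Then $$\lim_{n\to\infty}\left\|U_{2,n,h}-I_2(S,h,\cdot)\right\|_p=0.$$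
   Context: $(\Omega,\mathcal F,\mathbb P)$ is a probability space and $T\colon\Omega\to\Omega$ is a measure-preserving map (invertible with measurable inverse, so that $T^i$ makes sense for all $i\in\mathbb Z$). $X_0\colon\Omega\to S$ is measurable for the Borel $\sigma$-algebra $\mathcal B(S)$ and $X_i=X_0\circ T^i$. No ergodicity is assumed. For $n\geq 2$, the $U$-statistic of order $2$ with kernel $h$ is $$U_{2,n,h}=\frac1{\binom n2}\sum_{1\leq i<j\leq n}h(X_i,X_j).$$ $\mathcal I$ denotes the $\sigma$-algebra of invariant sets, i.e. the sets $E\in\mathcal F$ such that $T^{-1}E=E$. The random probability measure $\mu_\omega$ on $\mathcal B(S)$ is defined by $\mu_\omega(A)=\mathbb E[\mathbf 1_{X_0\in A}\mid\mathcal I](\omega)$, $A\in\mathcal B(S)$ (a regular conditional distribution of $X_0$ given $\mathcal I$). For a function $g\colon S^2\to\mathbb R$, $$I_2(S,g,\omega)=\int_{S^2}g(x,y)\,d\mu_\omega(x)\,d\mu_\omega(y),$$ and $I_2(S,g,\cdot)$ denotes the random variable $\omega\mapsto I_2(S,g,\omega)$. For a real random variable $Z$, $\|Z\|_p=(\mathbb E[|Z|^p])^{1/p}$. *)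

(* Defs.v *)
From HB Require Import structures.
From mathcomp Require Import all_boot all_order all_algebra.
From mathcomp Require Import all_classical all_reals all_analysis.

Set Implicit Arguments.
Unset Strict Implicit.
Unset Printing Implicit Defensive.

Import Order.TTheory GRing.Theory Num.Theory.
Import numFieldNormedType.Exports.

Local Open Scope classical_set_scope.
Local Open Scope ring_scope.

(* A measurableType carries a base point, so a metric space with its Borel
   sigma-algebra needs one too.  This only excludes the empty space. *)
#[short(type="pmetricType")]
HB.structure Definition PMetric (K : numDomainType) :=
  {M of Metric K M & Pointed M}.

Notation borel S := (g_sigma_algebraType (@open S)).

Definition separable (S : topologicalType) : Prop :=
  exists2 A : set S, countable A & dense A.

Definition discontinuity_set (S S' : topologicalType) (f : S -> S') : set S :=
  [set z | ~ {for z, continuous f}].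

Section stationary.
Context {d : measure_display} {Omega : measurableType d} {R : realType}.
Variable P : probability Omega R.

Definition mp_automorphism (T Tinv : Omega -> Omega) : Prop :=
  [/\ cancel T Tinv, cancel Tinv T,
      measurable_fun setT T, measurable_fun setT Tinv &
      forall A, measurable A -> P (T @^-1` A) = P A].

Definition iterz (T Tinv : Omega -> Omega) (i : int) : Omega -> Omega :=
  match i with
  | Posz n => iter n T
  | Negz n => iter n.+1 Tinv
  end.

Definition orbit_process (S : Type) (T Tinv : Omega -> Omega) (X0 : Omega -> S)
  (i : int) : Omega -> S := X0 \o iterz T Tinv i.

Definition invariant_sets (T : Omega -> Omega) : set (set Omega) :=
  [set E | measurable E /\ T @^-1` E = E].

(* [Y] is a version of the conditional expectation of the integrable random
   variable [X] given the sub-sigma-algebra [G]. *)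
Definition is_cond_exp (G : set (set Omega)) (X Y : Omega -> R) : Prop :=
  [/\ forall B : set R, measurable B -> G (Y @^-1` B),
      P.-integrable setT (EFin \o Y) &
      forall E, G E ->
        (\int[P]_(w in E) (Y w)%:E = \int[P]_(w in E) (X w)%:E)%E].

Definition regular_cond_dist d' (S : measurableType d') (G : set (set Omega))
    (X : Omega -> S) (mu : Omega -> probability S R) : Prop :=
  forall A : set S, measurable A ->
    is_cond_exp G (\1_(X @^-1` A)) (fun w => fine (mu w A)).

Definition uniformly_integrable (I : Type) (D : set I) (Z : I -> Omega -> R) :
    Prop :=
  ereal_sup [set (\int[P]_(w in [set w | (c < `|Z i w|)%R]) `|Z i w|%:E)%E
            | i in D] @[c --> +oo%R] --> 0%E.

End stationary.

Definition ustat2 (R : realType) (Omega S : Type) (X : int -> Omega -> S)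
    (h : S * S -> R) (n : nat) (w : Omega) : R :=
  'C(n, 2)%:R^-1 *
  \sum_(1 <= i < n.+1) \sum_(1 <= j < n.+1 | (i < j)%N) h (X i w, X j w).

(* When [g] is not integrable for [mu w \x mu w], the value is a default real. *)
Definition I2 d' (S : measurableType d') (R : realType) (Omega : Type)
    (mu : Omega -> probability S R) (g : S * S -> R) (w : Omega) : R :=
  (\int[(mu w \x mu w)%E]_z g z)%R.

(* Main.v *)
Require Import Defs.
From mathcomp Require Import all_boot all_order all_algebra.
From mathcomp Require Import all_classical all_reals all_analysis.
From mathcomp Require Import measurable_realfun giry ring lra.

Set Implicit Arguments.
Unset Strict Implicit.
Unset Printing Implicit Defensive.

Import Order.TTheory GRing.Theory Num.Theory.
Import numFieldNormedType.Exports.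

Local Open Scope classical_set_scope.
Local Open Scope ring_scope.

(** The argument is pointwise in [w] for bounded kernels, and truncation does the
    rest.

    Fix [w] and write [m] for [mu w].  Birkhoff's theorem ([birkhoff]), applied to
    the indicators [\1_A (X0 w)], says that along almost every orbit the frequency
    of visits to [A] is [mu w A]: the regular conditional distribution supplies
    exactly what the ergodic averages converge to, namely an invariant function
    with the right integral over every invariant set.  The maximal inequality
    behind it ([integral_escape_ge0]) takes the set where the maximal ergodic sums
    are unbounded, which is strictly invariant, and compares consecutive maximal
    sums there.

    Summing over the ordered pairs [i < j] only, instead of all pairs, does not
    change the limit of averages of a product [a_i * b_j]: by Abel summation both
    factors may be replaced by their limits ([pair_mean_prod_cvg]).  Hence
    U-statistics of indicators of measurable rectangles converge to
    [m A * m B].  A bounded kernel [h] with [m \x m]-negligible discontinuities is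
    approximated from above and from below by such kernels: the first [k] sets of a
    countable base of [S] cut [S] into finitely many cells, and the supremum of [h]
    over the cell of [z] decreases to [h z] wherever [h] is continuous
    ([step_sup_cvg]).  As the U-statistic is monotone in the kernel, this gives
    almost sure convergence for bounded [h] ([pair_mean_cvg_integral]), hence
    convergence in [L^p] by dominated convergence ([Lp_pair_mean_cvg]).

    A general [h] is replaced by its truncation [clamp K \o h], which has no new
    discontinuity.  Jensen's inequality bounds the [p]-th moment of the error made
    in the U-statistic by the [p]-th moments of [h (X i w, X j w)] beyond level [K],
    which uniform integrability makes small ([uniform_truncation]), and that of the
    error made in the limit by an integral of [|h| ^ p] beyond level [K], small
    by dominated convergence ([ae_I2_truncation], [truncated_integral_cvg0]). *)

(** * Integrals of bounded functions *)

Section finite_measure.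
Context {d : measure_display} {U : measurableType d} {R : realType}.
Variable m : {measure set U -> \bar R}.
Hypothesis mfin : (m setT < +oo)%E.

Lemma bounded_integrable (E : set U) (f : U -> R) (C : R) :
  measurable E -> measurable_fun setT f -> (forall x, `|f x| <= C) ->
  m.-integrable E (EFin \o f).
Proof.
move=> mE mf fC; apply: (@integrableS _ _ _ _ setT) => //.
apply: measurable_bounded_integrable => //.
by exists C; split; rewrite ?num_real// => M CM x _ /=; exact: (le_trans (fC _) (ltW CM)).
Qed.

Lemma bounded_convergence (E : set U) (f_ : nat -> U -> R) (f : U -> R) (C : R) :
  measurable E -> (forall n, measurable_fun setT (f_ n)) ->
  measurable_fun setT f -> (forall n x, `|f_ n x| <= C) ->
  {ae m, forall x, E x -> f_ n x @[n --> \oo] --> f x} ->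
  \int[m]_(x in E) f_ n x @[n --> \oo] --> \int[m]_(x in E) f x.
Proof.
move=> mE mf_ mf f_C f_f.
have [|||||fi _ /=] := @dominated_convergence _ _ _ m _ mE
   (fun n x => (f_ n x)%:E) (EFin \o f) (cst C%:E).
- by move=> n; apply/measurable_EFinP; exact: measurable_funTS.
- by apply/measurable_EFinP; exact: measurable_funTS.
- by apply: filterS f_f => x + Ex => /(_ Ex) fx; apply: cvg_EFin; [exact: nearW | exact: fx].
- exact: (@bounded_integrable _ (cst C) `|C|).
- by apply: aeW => w n _ /=; rewrite lee_fin; exact: f_C.
- move=> fcvg; apply: fine_cvg; rewrite fineK//.
  exact: integrable_fin_num.
Qed.

Lemma Rintegral_sum (I : finType) (E : set U) (F : I -> U -> R) :
  measurable E -> (forall i, m.-integrable E (EFin \o F i)) ->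
  \int[m]_(x in E) (\sum_i F i x) = \sum_i \int[m]_(x in E) F i x.
Proof.
move=> mE iF; rewrite /Rintegral.
under eq_integral do rewrite -sumEFin.
rewrite integral_sum// -sum_fine// => i _; exact: (integrable_fin_num mE (iF i)).
Qed.

End finite_measure.

Lemma product_probability_setT {d : measure_display} {U : measurableType d}
  {R : realType} (m : probability U R) : (m \x m)%E setT = 1%E.
Proof.
rewrite -setXTT [LHS](product_measure1E m m)//.
by rewrite [X in (X * _)%E]probability_setT mul1e [LHS]probability_setT.
Qed.

(** * Birkhoff's ergodic theorem *)

(** Convergence of the averages of [a] to [l], in additive form: the constant [K]
    absorbs the initial terms, so that bounds on partial sums can be summed again
    without any splitting of the range.  Summation starts at [1], as in U-statistics. *)
Definition cesaro_cvg (R : realType) (a : nat -> R) (l : R) : Prop :=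
  forall e : R, 0 < e ->
    exists K : R, forall n, `|\sum_(1 <= i < n.+1) (a i - l)| <= K + e * n%:R.

Section ergodic.
Context {d : measure_display} {Omega : measurableType d} {R : realType}.
Variables (P : probability Omega R) (T : Omega -> Omega).
Hypothesis mT : measurable_fun setT T.
Hypothesis TP : forall A, measurable A -> P (T @^-1` A) = P A.

Let Pfin : (P setT < +oo)%E.
Proof. by rewrite [X in (X < _)%E]probability_setT ltry. Qed.

Lemma Rintegral_invariant (f : Omega -> R) (C : R) (E : set Omega) :
  measurable E -> T @^-1` E = E -> measurable_fun setT f ->
  (forall w, `|f w| <= C) ->
  \int[P]_(w in E) f (T w) = \int[P]_(w in E) f w.
Proof.
move=> mE TE mf fC; rewrite /Rintegral; congr fine.
rewrite -{1}TE -[LHS](@integral_pushforward _ _ _ _ _ T mT P E (EFin \o f)) //.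
- by apply: eq_measure_integral => A mA _; exact: TP.
- exact/measurable_EFinP.
- rewrite TE; apply: (@bounded_integrable _ _ _ P _ _ (f \o T) C) => //.
  exact: measurableT_comp.
by move=> w; exact: fC.
Qed.

(** The largest of the ergodic sums of lengths [0] to [n], by the recursion that
    the proof exploits. *)
Fixpoint maxsum (f : Omega -> R) (n : nat) (w : Omega) : R :=
  if n is n'.+1 then Num.max 0 (f w + maxsum f n' (T w)) else 0.

Definition escape (f : Omega -> R) : set Omega :=
  [set w | forall K : nat, exists n, K%:R < maxsum f n w].

Section maxsum.
Variables (f : Omega -> R) (C : R).
Hypotheses (mf : measurable_fun setT f) (fC : forall w, `|f w| <= C).

Let M := maxsum f.

Lemma maxsum_ge0 n w : 0 <= M n w.
Proof. by case: n => [|n] //=; rewrite le_max lexx. Qed.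

Lemma maxsum_leS n w : M n w <= M n.+1 w.
Proof.
elim: n w => [|n IHn] w; first exact: maxsum_ge0.
rewrite /M /= ge_max le_max lexx /= le_max; apply/orP; right.
by rewrite lerD2l; exact: IHn.
Qed.

Lemma maxsum_nondecreasing m n w : (m <= n)%N -> M m w <= M n w.
Proof.
move=> /subnK <-; elim: (n - m)%N => [|k IHk]; first by rewrite add0n.
by rewrite addSn; exact: (le_trans IHk (maxsum_leS _ _)).
Qed.

Lemma sum_le_maxsum n w : \sum_(0 <= i < n) f (iter i T w) <= M n w.
Proof.
elim: n w => [|n IHn] w; first by rewrite big_nil.
rewrite big_nat_recl//= /M /= le_max; apply/orP; right; rewrite lerD2l.
rewrite (eq_bigr (fun i => f (iter i T (T w)))); first exact: IHn.
by move=> i _; rewrite -iterS iterSr.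
Qed.

Lemma maxsum_bounded n w : `|M n w| <= C * n%:R.
Proof.
rewrite ger0_norm ?maxsum_ge0//.
have C0 : 0 <= C by exact: (le_trans (normr_ge0 _) (fC w)).
elim: n w => [|n IHn] w; first by rewrite mulr0.
rewrite /M /= ge_max mulr_ge0//= -natr1 mulrDr mulr1 addrC lerD//.
by move: (fC w); rewrite ler_norml => /andP[].
Qed.

Lemma measurable_maxsum n : measurable_fun setT (M n).
Proof.
elim: n => [|n IHn]; first exact: measurable_cst.
rewrite /M /=; apply: measurable_maxr => //; apply: measurable_funD => //.
exact: (measurableT_comp IHn).
Qed.

Lemma measurable_escape : measurable (escape f).
Proof.
rewrite [escape f](_ : _ = \bigcap_(K : nat) \bigcup_n (M n @^-1` `]K%:R, +oo[)).
  apply: bigcapT_measurable => K; apply: bigcupT_measurable => n.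
  by rewrite -[X in measurable X]setTI; exact: measurable_maxsum.
apply/seteqP; split => w /=.
  by move=> wE K _; have [n] := wE K; exists n => //=; rewrite in_itv/= andbT.
by move=> wE K; have [n _] := wE K I; rewrite /= in_itv/= andbT; exists n.
Qed.

(** Shifting the orbit changes the maximal sums by at most [C] and one unit of
    time, which does not affect unboundedness: invariance is exact, not up to a
    null set. *)
Lemma escape_invariant : T @^-1` escape f = escape f.
Proof.
apply/seteqP; split => w /= wE K.
- have [n KM] := wE (Num.truncn (K%:R + C)).+1; exists n.+1.
  have := truncnS_gt (K%:R + C); have := fC w; rewrite ler_norml => /andP[+ _].
  rewrite /= lt_max => ? ?; apply/orP; right; lra.
- have [[|n]] := wE (Num.truncn (K%:R + C)).+1 => /=.
    by rewrite ltNge ler0n.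
  rewrite lt_max ltNge ler0n /= => KM; exists n.
  have := truncnS_gt (K%:R + C); have := fC w; rewrite ler_norml => /andP[_].
  lra.
Qed.

Lemma maxsum_step n w :
  M n.+1 w - M n (T w) = Num.max (f w) (- M n (T w)).
Proof.
rewrite /M /=; set m := maxsum f n (T w).
by case: (leP 0 (f w + m)) => ?; case: (leP (f w) (- m)) => ?; lra.
Qed.

(** Maximal ergodic inequality.  The increment [M n.+1 w - M n (T w)] equals
    [max (f w) (- M n (T w))]; its integral over the invariant set is nonnegative,
    since [M] increases with [n] and [T] preserves the measure, while on [escape f]
    it is eventually equal to [f w]. *)
Lemma integral_escape_ge0 : 0 <= \int[P]_(w in escape f) f w.
Proof.
have mE := measurable_escape.
pose g n w := Num.max (f w) (- M n (T w)).
have mg n : measurable_fun setT (g n).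
  apply: measurable_maxr => //; apply: measurableT_comp => //.
  exact: (measurableT_comp (measurable_maxsum n)).
have gC n w : `|g n w| <= C.
  rewrite /g; case: (leP (f w)) => h //.
  have := fC w; rewrite !ler_norml => /andP[? ?].
  have := maxsum_ge0 n (T w) => ?; apply/andP; split; lra.
have g_ge0 n : 0 <= \int[P]_(w in escape f) g n w.
  have -> : \int[P]_(w in escape f) g n w =
      \int[P]_(w in escape f) (M n.+1 w - (M n \o T) w).
    by apply: eq_Rintegral => w _; rewrite -[(M n \o T) w]/(M n (T w)) maxsum_step.
  have iM k : P.-integrable (escape f) (EFin \o M k).
    by apply: (@bounded_integrable _ _ _ P _ _ _ (C * k%:R)) => //;
      [exact: measurable_maxsum | exact: maxsum_bounded].
  rewrite RintegralB//; last first.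
    apply: (@bounded_integrable _ _ _ P _ _ _ (C * n%:R)) => //.
      exact: (measurableT_comp (measurable_maxsum n)).
    by move=> w; exact: maxsum_bounded.
  rewrite subr_ge0 (@Rintegral_invariant _ (C * n%:R)) => //.
  - by apply: le_Rintegral => // w _; exact: maxsum_leS.
  - exact: escape_invariant.
  - exact: measurable_maxsum.
  - exact: maxsum_bounded.
suff gf : \int[P]_(w in escape f) g n w @[n --> \oo] -->
    \int[P]_(w in escape f) f w.
  rewrite -(cvg_lim _ gf)//; apply: limr_ge; first exact: (cvgP _ gf).
  exact: nearW.
apply: (bounded_convergence Pfin mE mg mf gC); apply: aeW => w wE.
apply: cvg_near_cst.
have wTE : escape f (T w).
  by rewrite -[escape f (T w)]/((T @^-1` escape f) w) escape_invariant.
have [N NC] := wTE (Num.truncn C).+1.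
exists N => // k /= Nk; rewrite /g; apply/max_idPl.
have := maxsum_nondecreasing (T w) Nk; have := truncnS_gt C.
by have := fC w; rewrite ler_norml => /andP[]; move: NC; rewrite -/M; lra.
Qed.

(** A strictly negative mean on non-null invariant sets contradicts
    [integral_escape_ge0] unless [escape f] is negligible. *)
Lemma birkhoff_upper_bound (e : R) : 0 < e ->
  (forall E, measurable E -> T @^-1` E = E ->
    \int[P]_(w in E) f w <= - e * fine (P E)) ->
  {ae P, forall w, exists K : R, forall n,
    \sum_(1 <= i < n.+1) f (iter i T w) <= K}.
Proof.
move=> e0 fE; have mE := measurable_escape; exists (escape f); split => //.
  have := le_trans integral_escape_ge0 (fE _ mE escape_invariant).
  rewrite mulNr oppr_ge0 pmulr_rle0// => PE.
  have : P (escape f) \is a fin_num by exact: fin_num_measure.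
  by move=> /fineK <-; congr EFin; apply/eqP; rewrite eq_le PE fine_ge0.
move=> w /=; rewrite -escape_invariant /= => wE K; apply: contrapT => MK.
(* invariance of the escape set lets the sum start at time 1 *)
apply: wE; exists K%:R => n; rewrite big_add1/=.
rewrite (eq_bigr (fun i => f (iter i T (T w)))); last first.
  by move=> i _; rewrite -iterS iterSr.
apply: (le_trans (sum_le_maxsum _ _)); rewrite leNgt; apply/negP => KM.
by apply: MK; exists n.
Qed.

End maxsum.

(** Subtracting [e] makes the mean of [f - g] over each non-null invariant set
    strictly negative. *)
Lemma birkhoff_upper (f g : Omega -> R) (C e : R) :
  measurable_fun setT f -> measurable_fun setT g ->
  (forall w, `|f w| <= C) -> (forall w, `|g w| <= C) ->
  (forall w, g (T w) = g w) ->
  (forall E, measurable E -> T @^-1` E = E ->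
    \int[P]_(w in E) f w = \int[P]_(w in E) g w) ->
  0 < e ->
  {ae P, forall w, exists K : R, forall n,
    \sum_(1 <= i < n.+1) (f (iter i T w) - g w) <= K + e * n%:R}.
Proof.
move=> mf mg fC gC gT fgE e0.
have := @birkhoff_upper_bound (fun w => f w - g w - e) (C + C + e) _ _ _ e0.
case=> [||E mE TE|N [mN PN wN]].
- by apply: measurable_funB => //; exact: measurable_funB.
- move=> w; have := fC w; have := gC w; rewrite !ler_norml.
  by move=> /andP[? ?] /andP[? ?]; apply/andP; split; lra.
- have ifE := bounded_integrable Pfin mE mf fC.
  have igE := bounded_integrable Pfin mE mg gC.
  rewrite RintegralB//; last 2 first.
  + by rewrite [X in P.-integrable _ X](_ : _ = (EFin \o f) \- (EFin \o g))%E//;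
      exact: integrableB.
  + exact: finite_measure_integrable_cst.
  by rewrite RintegralB// fgE// subrr sub0r Rintegral_cst// mulNr.
exists N; split => // w /= Kw; apply: wN => /= -[K nK]; apply: Kw; exists K => n.
rewrite -lerBlDr; suff <- : \sum_(1 <= i < n.+1)
    (f (iter i T w) - g (iter i T w) - e) =
  \sum_(1 <= i < n.+1) (f (iter i T w) - g w) - e * n%:R by exact: nK.
have gi i : g (iter i T w) = g w by elim: i => [//|i IHi]; rewrite iterS gT.
under eq_bigr do rewrite gi.
by rewrite [in LHS]sumrB sumr_const_nat subn1/= mulr_natr.
Qed.

(** The limit [g] is prescribed: it is any bounded invariant function with the same
    integrals as [f] over the invariant sets, that is, a version of the conditional
    expectation of [f]. *)
Theorem birkhoff (f g : Omega -> R) (C : R) :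
  measurable_fun setT f -> measurable_fun setT g ->
  (forall w, `|f w| <= C) -> (forall w, `|g w| <= C) ->
  (forall w, g (T w) = g w) ->
  (forall E, measurable E -> T @^-1` E = E ->
    \int[P]_(w in E) f w = \int[P]_(w in E) g w) ->
  {ae P, forall w, cesaro_cvg (fun i => f (iter i T w)) (g w)}.
Proof.
move=> mf mg fC gC gT fgE.
have e0 (m : nat) : 0 < m.+1%:R^-1 :> R by [].
have := ae_foralln (fun m => birkhoff_upper mf mg fC gC gT fgE (e0 m)).
(* the lower bound is the upper bound for the opposite functions *)
have Nae m : {ae P, forall w, exists K : R, forall n, - \sum_(1 <= i < n.+1)
    (f (iter i T w) - g w) <= K + m.+1%:R^-1 * n%:R}.
  have Nfg := @birkhoff_upper (\- f) (\- g) C m.+1%:R^-1.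
  apply: filterS (Nfg _ _ _ _ _ _ _) => [w [K nK]||||||E mE TE|].
  - exists K => n; apply: le_trans (nK n).
    rewrite -sumrN; apply: ler_sum => i _ /=; lra.
  - exact: measurableT_comp.
  - exact: measurableT_comp.
  - by move=> w; rewrite normrN.
  - by move=> w; rewrite normrN.
  - by move=> w /=; rewrite gT.
  - rewrite (_ : (\- f) = (fun w => -1 * f w)); last by apply/funext => w; rewrite mulN1r.
    rewrite (_ : (\- g) = (fun w => -1 * g w)); last by apply/funext => w; rewrite mulN1r.
    have ifE := bounded_integrable Pfin mE mf fC.
    have igE := bounded_integrable Pfin mE mg gC.
    by rewrite !RintegralZl ?fgE.
  - exact: e0.
have := ae_foralln Nae.
apply: filterS2 => w lw uw e e_gt0.
have [m me] : exists m : nat, m.+1%:R^-1 < e.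
  exists (Num.truncn e^-1); rewrite invf_plt ?posrE//; exact: truncnS_gt.
have [[K nK] [K' nK']] := (lw m, uw m).
exists (`|K| + `|K'|) => n; rewrite ler_norml; apply/andP; split.
all: have := nK n; have := nK' n; have := ler_norm K; have := ler_norm K'.
all: have := normr_ge0 K; have := normr_ge0 K'.
all: have : m.+1%:R^-1 * n%:R <= e * n%:R by rewrite ler_wpM2r// ltW.
all: move: (_^-1 * _) (e * _) (\sum_(_ <= _ < _) _) => *; lra.
Qed.

End ergodic.

(** * Averages over ordered pairs *)

Section pair_mean.
Context {R : realType}.
Implicit Types (F G : nat -> nat -> R) (a b : nat -> R).

Definition pair_sum n F : R :=
  \sum_(1 <= i < n.+1) \sum_(1 <= j < n.+1 | (i < j)%N) F i j.

Definition pair_mean n F : R := 'C(n, 2)%:R^-1 * pair_sum n F.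

Lemma pair_sum_swap n F : pair_sum n F =
  \sum_(1 <= j < n.+1) \sum_(1 <= i < j) F i j.
Proof.
rewrite /pair_sum (exchange_big_dep xpredT)//=; apply: eq_big_nat => j /andP[_ jn].
by rewrite [RHS](big_nat_widen 1 j n.+1) // ltnW.
Qed.

Lemma pair_sumE n F :
  pair_sum n F = \sum_(1 <= i < n.+1) \sum_(i.+1 <= j < n.+1) F i j.
Proof. by apply: eq_bigr => i _; rewrite (big_nat_widenl i.+1 1). Qed.

Lemma pair_sumD n F G :
  pair_sum n (fun i j => F i j + G i j) = pair_sum n F + pair_sum n G.
Proof. by rewrite -big_split/=; apply: eq_bigr => i _; rewrite big_split. Qed.

Lemma pair_sumZ n (c : R) F :
  pair_sum n (fun i j => c * F i j) = c * pair_sum n F.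
Proof. by rewrite mulr_sumr; apply: eq_bigr => i _; rewrite mulr_sumr. Qed.

Lemma pair_sum_cst n (c : R) : pair_sum n (fun _ _ => c) = c * 'C(n, 2)%:R.
Proof.
rewrite pair_sum_swap big_add1/= -bin2_sum natr_sum mulr_sumr; apply: eq_bigr => j _.
by rewrite sumr_const_nat subn1 /= mulr_natr.
Qed.

Lemma ler_pair_sum n F G : (forall i j, (1 <= i < j)%N -> F i j <= G i j) ->
  pair_sum n F <= pair_sum n G.
Proof.
move=> FG; rewrite !pair_sumE; apply: ler_sum_nat => i /andP[i1 _].
by apply: ler_sum_nat => j /andP[ij _]; apply: FG; rewrite i1.
Qed.

Lemma ler_pair_mean n F G : (forall i j, (1 <= i < j)%N -> F i j <= G i j) ->
  pair_mean n F <= pair_mean n G.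
Proof.
by move=> FG; rewrite ler_wpM2l ?invr_ge0// ler_pair_sum.
Qed.

Lemma pair_mean_ge0 n F : (forall i j, 0 <= F i j) -> 0 <= pair_mean n F.
Proof.
move=> F0; rewrite mulr_ge0 ?invr_ge0//.
by apply: sumr_ge0 => i _; exact: sumr_ge0.
Qed.

Lemma pair_mean_cst n (c : R) : (1 < n)%N -> pair_mean n (fun _ _ => c) = c.
Proof.
move=> n1; rewrite /pair_mean pair_sum_cst mulrC mulfK//.
by rewrite pnatr_eq0 -lt0n bin_gt0.
Qed.

Lemma pair_meanD n F G :
  pair_mean n (fun i j => F i j + G i j) = pair_mean n F + pair_mean n G.
Proof. by rewrite /pair_mean pair_sumD mulrDr. Qed.

Lemma pair_meanZ n (c : R) F :
  pair_mean n (fun i j => c * F i j) = c * pair_mean n F.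
Proof. by rewrite /pair_mean pair_sumZ mulrCA. Qed.

Lemma pair_mean_sum (I : finType) n (F : I -> nat -> nat -> R) :
  pair_mean n (fun i j => \sum_k F k i j) = \sum_k pair_mean n (F k).
Proof.
rewrite /pair_mean -mulr_sumr; congr (_ * _); rewrite /pair_sum exchange_big/=.
by apply: eq_bigr => i _; rewrite exchange_big.
Qed.

Lemma ler_norm_pair_mean n F : `|pair_mean n F| <= pair_mean n (fun i j => `|F i j|).
Proof.
rewrite normrM normfV normr_nat ler_wpM2l ?invr_ge0//.
apply: (le_trans (ler_norm_sum _ _ _)); apply: ler_sum => i _.
exact: ler_norm_sum.
Qed.

Lemma pair_mean_bounded n F K : 0 <= K -> (forall i j, `|F i j| <= K) ->
  `|pair_mean n F| <= K.
Proof.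
move=> K0 FK; have [n1|n1] := ltnP 1 n.
  rewrite -(pair_mean_cst K n1); apply: le_trans (ler_norm_pair_mean _ _) _.
  exact: ler_pair_mean.
(* without any pair the normalization is the inverse of 0, that is 0 *)
by rewrite /pair_mean bin_small// invr0 mul0r normr0.
Qed.

Lemma cvg_pair_mean F (l : R) :
  (forall e : R, 0 < e -> exists K : R, forall n,
    `|pair_sum n (fun i j => F i j - l)| <= n%:R * (K + e * n%:R)) ->
  pair_mean n F @[n --> \oo] --> l.
Proof.
move=> Fl; apply/cvgrPdist_le => e e0.
(* for [1 < n], [n <= 2 * n.-1] and ['C(n, 2) = n * n.-1 / 2], hence
   [n * (K + e / 8 * n)] is at most ['C(n, 2) * e] once [4 * K <= e * n.-1] *)
have [K nK] := Fl (e / 8) ltac:(lra).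
exists (Num.truncn (4 * `|K| / e)).+2 => // n /= nN.
have n1 : (1 < n)%N by exact: leq_trans nN.
have C0 : 0 < 'C(n, 2)%:R :> R by rewrite ltr0n bin_gt0.
have -> : l - pair_mean n F = - ('C(n, 2)%:R^-1 * pair_sum n (fun i j => F i j - l)).
  by rewrite -/(pair_mean n _) pair_meanD pair_mean_cst// opprB.
rewrite normrN normrM normfV normr_nat ler_pdivrMl//.
apply: (le_trans (nK n)).
have Kn : 4 * `|K| <= e * n.-1%:R.
  rewrite -ler_pdivrMl// mulrC; apply/ltW/(lt_le_trans (truncnS_gt _)).
  by rewrite ler_nat -ltnS prednK// ltnW.
have nn : n%:R = n.-1%:R + 1 :> R by rewrite natr1 prednK// ltnW.
have n1' : 1 <= n.-1%:R :> R by rewrite ler1n -ltnS prednK// ltnW.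
have C2 : n%:R * n.-1%:R = 2 * 'C(n, 2)%:R :> R by rewrite -!natrM -mul_bin_diag bin1.
have n0 : 0 <= n%:R :> R by [].
have -> : 'C(n, 2)%:R * e = n%:R * (n.-1%:R * (e / 2)).
  by rewrite mulrA C2; lra.
rewrite ler_wpM2l//.
have := ler_norm K; have : e <= e * n.-1%:R by rewrite ler_peMr// ltW.
by rewrite nn; lra.
Qed.

(** A tail is a difference of two partial sums, each of them bounded. *)
Lemma sum_tail_cesaro b (l K e : R) i n : (1 <= i <= n)%N -> 0 <= e ->
  (forall n, `|\sum_(1 <= j < n.+1) (b j - l)| <= K + e * n%:R) ->
  `|\sum_(i.+1 <= j < n.+1) (b j - l)| <= 2 * (K + e * n%:R).
Proof.
move=> /andP[i1 iN] e0 bK.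
have : e * i%:R <= e * n%:R by rewrite ler_wpM2l// ler_nat.
have := bK n; have := bK i.
rewrite (@big_cat_nat _ _ _ i.+1 1 n.+1)//= !ler_norml.
move: (\sum_(_ <= _ < _) _) (\sum_(i.+1 <= _ < _) _) => s t.
by move=> /andP[? ?] /andP[? ?] ?; apply/andP; split; lra.
Qed.

(** Write [a i * b j - la * lb] as [b j * (a i - la) + la * (b j - lb)].  In the
    first part the sum over [i < j] is a partial sum, in the second one the sum over
    [j > i] is a tail; both are negligible with respect to [n], and there are [n] of
    them. *)
Theorem pair_mean_prod_cvg a b (la lb B : R) : (forall j, `|b j| <= B) ->
  cesaro_cvg a la -> cesaro_cvg b lb ->
  pair_mean n (fun i j => a i * b j) @[n --> \oo] --> la * lb.
Proof.
move=> bB ala blb; apply: cvg_pair_mean => e e0.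
have B0 : 0 <= B by exact: (le_trans (normr_ge0 _) (bB 0%N)).
(* the two parts contribute [B] and [2 * `|la|]; the [1] makes [D] positive *)
pose D := B + 2 * `|la| + 1.
have D0 : 0 < D by rewrite /D ltr_wpDl// addr_ge0// mulr_ge0.
have [Ka aK] := ala (e / D) (divr_gt0 e0 D0).
have [Kb bK] := blb (e / D) (divr_gt0 e0 D0).
have Ka0 : 0 <= Ka by have := aK 0%N; rewrite big_geq// normr0 mulr0 addr0.
have Kb0 : 0 <= Kb by have := bK 0%N; rewrite big_geq// normr0 mulr0 addr0.
exists (B * Ka + 2 * `|la| * Kb) => n.
have eD0 : 0 <= e / D by rewrite ltW// divr_gt0.
rewrite [pair_sum n _](_ : _ = pair_sum n (fun i j => b j * (a i - la)) +
  la * pair_sum n (fun i j => b j - lb)); last first.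
  rewrite -pair_sumZ -pair_sumD; apply: eq_bigr => i _; apply: eq_bigr => j _; lra.
have S1 : `|pair_sum n (fun i j => b j * (a i - la))| <=
    n%:R * (B * (Ka + e / D * n%:R)).
  rewrite pair_sum_swap; apply: (le_trans (ler_norm_sum _ _ _)).
  have -> : n%:R * (B * (Ka + e / D * n%:R)) =
     \sum_(1 <= j < n.+1) (B * (Ka + e / D * n%:R)).
    by rewrite sumr_const_nat subn1/= mulr_natl.
  apply: ler_sum_nat => j /andP[j1 jn]; rewrite -mulr_sumr normrM ler_pM//.
  case: j j1 jn => // j _ jn; apply: (le_trans (aK j)); rewrite lerD2l.
  by rewrite ler_wpM2l// ler_nat ltnW.
have S2 : `|pair_sum n (fun i j => b j - lb)| <=
    n%:R * (2 * (Kb + e / D * n%:R)).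
  rewrite pair_sumE; apply: (le_trans (ler_norm_sum _ _ _)).
  have -> : n%:R * (2 * (Kb + e / D * n%:R)) =
     \sum_(1 <= j < n.+1) (2 * (Kb + e / D * n%:R)).
    by rewrite sumr_const_nat subn1/= mulr_natl.
  by apply: ler_sum_nat => i /andP[i1 iN]; apply: sum_tail_cesaro => //; rewrite i1.
apply: (le_trans (ler_normD _ _)); rewrite normrM.
have := ler_wpM2l (normr_ge0 la) S2.
have De : (B + 2 * `|la|) * (e / D) <= e.
  by rewrite mulrCA ger_pMr// ler_pdivrMr// mul1r /D; lra.
have := ler_wpM2r (ler0n R n) De => /(ler_wpM2l (ler0n R n)).
move: S1; lra.
Qed.

End pair_mean.

(** * Countable base and measurability of the discontinuity set *)

Lemma separable_base (R : realType) (S : pmetricType R) : separable S ->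
  exists2 V : nat -> set S, (forall i, open (V i)) &
    forall x U, nbhs x U -> exists2 i, V i x & V i `<=` U.
Proof.
move=> [A /pcard_surjP[g gA] denseA].
pose V i := if unpickle i is Some nm then
  (ball (g nm.1) (nm.2.+1%:R^-1 : R))° else set0.
exists V => [i|x U].
  by rewrite /V; case: unpickle => [?|]; [exact: open_interior|exact: open0].
rewrite -nbhs_ballE => -[r /= r0 rU].
have [m mr] : exists m : nat, m.+1%:R^-1 < r / 2.
  exists (Num.truncn (r / 2)^-1); rewrite invf_plt ?posrE ?divr_gt0//.
  exact: truncnS_gt.
pose s := m.+1%:R^-1 / 2 : R.
have s0 : 0 < s by rewrite divr_gt0.
have [|a [/interior_subset xa Aa]] := denseA (ball x s)° _ (@open_interior _ _).
  by exists x; exact: nbhsx_ballx.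
have [n _ gn] := gA a Aa.
exists (pickle (n, m)); rewrite /V pickleK/= gn.
  rewrite /interior -nbhs_ballE; exists s => //= y xy.
  by rewrite [m.+1%:R^-1]splitr; apply: ball_triangle xy; exact: ball_sym.
apply: (subset_trans (@interior_subset _ _)) => y ay; apply: rU.
apply: (@le_ball _ _ _ (s + m.+1%:R^-1)); last exact: ball_triangle xa ay.
have : 0 < m.+1%:R^-1 :> R by [].
by move: mr; rewrite /s; move: (m.+1%:R^-1) => t; lra.
Qed.

Section discontinuity.
Context {R : realType} {S : pmetricType R} (V : nat -> set S).
Hypothesis openV : forall i, open (V i).
Hypothesis baseV : forall x U, nbhs x U -> exists2 i, V i x & V i `<=` U.

Lemma measurable_base i : measurable (V i : set (borel S)).
Proof. exact: sub_sigma_algebra. Qed.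

Definition small_oscillation (h : S * S -> R) (e : R) (W : set (S * S)) : Prop :=
  forall y z, W y -> W z -> `|h y - h z| <= e.

(** Testing continuity on boxes of the base, with the oscillation over the box in
    place of the distance to [h z], makes the condition on the box independent of
    [z]; this is what turns the set of continuity points into a countable
    combination of boxes below. *)
Lemma continuous_small_oscillation (h : S * S -> R) (z : S * S) :
  {for z, continuous h} <->
  forall e : R, 0 < e -> exists i j, [/\ V i z.1, V j z.2 &
    small_oscillation h e (V i `*` V j)].
Proof.
split=> [/cvgrPdist_le hz e e0|hz].
  have /hz [[A B]/= [/baseV[i Viz ViA] /baseV[j Vjz VjB]] AB] : 0 < e / 2 by lra.
  exists i, j; split => // -[y1 y2] [x1 x2] /= [/ViA y1A /VjB y2B] [/ViA x1A /VjB x2B].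
  have := AB (y1, y2) (conj y1A y2B); have := AB (x1, x2) (conj x1A x2B).
  rewrite /= !ler_norml.
  by move=> /andP[? ?] /andP[? ?]; apply/andP; split; lra.
apply/cvgrPdist_le => e e0; have [i [j [Viz Vjz osc]]] := hz e e0.
exists (V i, V j) => /=; first by split; apply: open_nbhs_nbhs.
by move=> y Vy; apply: osc.
Qed.

Lemma measurable_discontinuity (h : S * S -> R) :
  measurable (discontinuity_set h : set (borel S * borel S)).
Proof.
have -> : discontinuity_set h = ~` \bigcap_(n : nat) \bigcup_(ij : nat * nat)
   if `[< small_oscillation h n.+1%:R^-1 (V ij.1 `*` V ij.2) >]
   then V ij.1 `*` V ij.2 else set0.
  rewrite /discontinuity_set; congr (~` _); apply/seteqP; split => z /=.
    move=> /continuous_small_oscillation hz n _.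
    have [|i [j [Viz Vjz osc]]] := hz n.+1%:R^-1; first by [].
    by exists (i, j) => //=; rewrite asboolT.
  move=> hz; apply/continuous_small_oscillation => e e0.
  have [m me] : exists m : nat, m.+1%:R^-1 < e.
    exists (Num.truncn e^-1); rewrite invf_plt ?posrE//; exact: truncnS_gt.
  have [[i j] _ /=] := hz m I; case: asboolP => // osc [Viz Vjz].
  exists i, j; split => // x y /osc /[apply] /le_trans; apply; exact: ltW.
apply: measurableC; apply: bigcapT_measurable => n.
apply: countable_bigcupT_measurable => [|[i j]]; first exact: countableP.
by case: ifP => // _; apply: measurableX; exact: measurable_base.
Qed.

End discontinuity.

(** * Approximation of a kernel by step functions *)

Local Notation cell_index k :=
  ({ffun 'I_k -> bool} * {ffun 'I_k -> bool})%type.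

Section base_cells.
Context {R : realType} {S : pmetricType R} (V : nat -> set S).
Hypothesis openV : forall i, open (V i).
Hypothesis baseV : forall x U, nbhs x U -> exists2 i, V i x & V i `<=` U.

(** Which of the first [k] sets of the base contain [x]; the points of equal type
    form the cells of a finite partition of [S], finer and finer as [k] grows. *)
Definition base_type (k : nat) (x : S) : {ffun 'I_k -> bool} :=
  [ffun i : 'I_k => `[< V i x >]].

Definition base_cell (k : nat) (s : {ffun 'I_k -> bool}) : set S :=
  [set x | base_type k x = s].

Lemma measurable_base_cell k s : measurable (@base_cell k s : set (borel S)).
Proof.
rewrite (_ : base_cell s = \bigcap_(i : 'I_k)
    if s i then V i : set (borel S) else ~` V i); last first.
  apply/seteqP; split => x /=.
    by move=> <- i _; rewrite ffunE; case: asboolP.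
  move=> xs; apply/ffunP => i; rewrite ffunE; have := xs i I.
  by case: (s i) => [/asboolT|/asboolF].
apply: fin_bigcap_measurable => [|i _]; first exact: finite_finset.
by case: (s i); [|apply: measurableC]; exact: measurable_base.
Qed.

Definition cell_sup (h : S * S -> R) (k : nat) (st : cell_index k) : R :=
  sup (h @` (base_cell st.1 `*` base_cell st.2)).

Definition step_sup (h : S * S -> R) (k : nat) (z : S * S) : R :=
  cell_sup h (base_type k z.1, base_type k z.2).

Lemma step_supE h k z : step_sup h k z =
  \sum_(st : cell_index k)
     cell_sup h st * (\1_(base_cell st.1) z.1 * \1_(base_cell st.2) z.2).
Proof.
rewrite (bigD1 (base_type k z.1, base_type k z.2))//= big1 ?addr0.
  by rewrite !indicE !mem_set//= !mulr1.
move=> [s t] /=; rewrite xpair_eqE => /nandP[] /eqP st.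
  by rewrite (indicE _ (base_cell s)) memNset ?mul0r ?mulr0// => /esym.
by rewrite (indicE _ (base_cell t)) memNset ?mulr0// => /esym.
Qed.

Section step_sup.
Variables (h : S * S -> R) (K : R).
Hypothesis hK : forall z, `|h z| <= K.

Let cell z k := base_cell (base_type k z.1) `*` base_cell (base_type k z.2).

Lemma le_step_sup k z : h z <= step_sup h k z.
Proof.
apply: ub_le_sup; last by exists z.
by exists K => _ [y _ <-]; exact: le_trans (ler_norm _) (hK y).
Qed.

Lemma step_sup_le k z (M : R) : (forall y, cell z k y -> h y <= M) ->
  step_sup h k z <= M.
Proof.
move=> hM; apply: ge_sup; first by exists (h z); exists z.
by move=> _ [y /hM ? <-].
Qed.

Lemma step_sup_bounded k z : `|step_sup h k z| <= K.
Proof.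
have := le_step_sup k z; have := hK z; rewrite !ler_norml => /andP[h1 h2] h3.
rewrite (le_trans h1 h3) step_sup_le// => y _.
exact: le_trans (ler_norm _) (hK y).
Qed.

Lemma measurable_step_sup k :
  measurable_fun setT (step_sup h k : borel S * borel S -> R).
Proof.
rewrite (funext (step_supE h k)); apply: measurable_sum => st; apply: measurable_funM => //.
apply: measurable_funM.
- apply: (measurableT_comp (f := \1_(base_cell st.1 : set (borel S)) : borel S -> R)) => //.
  by apply: measurable_indic; exact: measurable_base_cell.
- apply: (measurableT_comp (f := \1_(base_cell st.2 : set (borel S)) : borel S -> R)) => //.
  by apply: measurable_indic; exact: measurable_base_cell.
Qed.

(** At a point of continuity some box [V i `*` V j] of the base around [z] has small
    oscillation, and the cell of [z] lies in that box as soon as [k] exceeds [i]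
    and [j]. *)
Lemma step_sup_cvg z : {for z, continuous h} ->
  step_sup h k z @[k --> \oo] --> h z.
Proof.
move=> /(continuous_small_oscillation openV baseV) hz.
apply/cvgrPdist_le => e e0; have [i [j [Viz Vjz osc]]] := hz e e0.
exists (maxn i j).+1 => // k /= kij.
rewrite distrC ger0_norm ?subr_ge0 ?le_step_sup// lerBlDr; apply: step_sup_le.
have [ik jk] : (i < k)%N /\ (j < k)%N.
  by split; apply: leq_trans kij; rewrite ltnS ?leq_maxl ?leq_maxr.
move=> y [/= /ffunP/(_ (Ordinal ik)) + /ffunP/(_ (Ordinal jk))].
rewrite !ffunE/= (asboolT Viz) (asboolT Vjz) => /asboolP Viy /asboolP Vjy.
by rewrite -lerBlDr; apply: le_trans (ler_norm _) (osc _ _ _ _).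
Qed.

End step_sup.
End base_cells.

(** * Equidistribution of pairs *)

Section equidistribution.
Context {R : realType} {S : pmetricType R} (V : nat -> set S).
Hypothesis openV : forall i, open (V i).
Hypothesis baseV : forall x U, nbhs x U -> exists2 i, V i x & V i `<=` U.
Variables (m : probability (borel S) R) (x : nat -> S).
Hypothesis xm : forall k (s : {ffun 'I_k -> bool}),
  cesaro_cvg (fun i => \1_(base_cell V s) (x i)) (fine (m (base_cell V s))).

Let m2 : {measure set (borel S * borel S) -> \bar R} := (m \x m)%E.

Let m2fin : (m2 setT < +oo)%E.
Proof. by rewrite [X in (X < _)%E]product_probability_setT ltry. Qed.

Lemma Rintegral_step_sup (h : S * S -> R) k :
  \int[m2]_z step_sup V h k z =
  \sum_(st : cell_index k) cell_sup V h st *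
     (fine (m (base_cell V st.1)) * fine (m (base_cell V st.2))).
Proof.
pose W (st : cell_index k) : set (borel S * borel S) :=
  base_cell V st.1 `*` base_cell V st.2.
have mW st : measurable (W st) by apply: measurableX; exact: measurable_base_cell.
have iW st : m2.-integrable setT (EFin \o (\1_(W st) : borel S * borel S -> R)).
  apply: (@bounded_integrable _ _ _ m2 m2fin _ _ 1) => //.
  by move=> z; rewrite indicE; case: (_ \in _); rewrite ?normr1 ?normr0.
transitivity (\int[m2]_z \sum_st (cell_sup V h st * \1_(W st) z)).
  apply: eq_Rintegral => z _; rewrite step_supE; apply: eq_bigr => st _.
  by rewrite !indicE -natrM mulnb -in_setX.
rewrite Rintegral_sum//; last first.
  by move=> st; exact: (integrableZl measurableT _ (iW st)).
apply: eq_bigr => st _; rewrite RintegralZl//; congr (_ * _).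
have mc (s : {ffun 'I_k -> bool}) := measurable_base_cell openV s.
rewrite /Rintegral integral_indic// setIT [X in fine X](product_measure1E m m)//.
by rewrite fineM//; exact: fin_num_measure.
Qed.

(** The step function [step_sup V h k] dominates [h], its pair averages converge to
    its integral by [pair_mean_prod_cvg], and this integral is close to that of [h]
    for large [k].  The lower bound follows by applying this to [- h]. *)
Lemma pair_mean_le_integral (h : S * S -> R) (K e : R) :
  measurable_fun setT (h : borel S * borel S -> R) -> (forall z, `|h z| <= K) ->
  m2 (discontinuity_set h) = 0%E -> 0 < e ->
  \forall n \near \oo,
    pair_mean n (fun i j => h (x i, x j)) <= \int[m2]_z h z + e.
Proof.
move=> mh hK hD e0.
have : \int[m2]_z step_sup V h k z @[k --> \oo] --> \int[m2]_z h z.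
  apply: (bounded_convergence m2fin measurableT (f_ := step_sup V h) (C := K)) => //.
  - by move=> k; exact: measurable_step_sup.
  - by move=> k z; exact: step_sup_bounded.
  exists (discontinuity_set h); split => //.
    exact: (measurable_discontinuity openV baseV).
  by move=> z /= hz hz'; apply: hz => _; exact: (step_sup_cvg openV baseV hK).
move=> /cvgrPdist_lt /(_ (e / 2)) -[|k _ /(_ k (leqnn k))]; first by lra.
rewrite Rintegral_step_sup => hk.
pose F (st : cell_index k) i j : R := cell_sup V h st *
  (\1_(base_cell V st.1) (x i) * \1_(base_cell V st.2) (x j)).
have Fcvg : \sum_st pair_mean n (F st) @[n --> \oo] -->
    \sum_(st : cell_index k) cell_sup V h st *
     (fine (m (base_cell V st.1)) * fine (m (base_cell V st.2))).
  apply: cvg_big => [|st _]; first exact: add_continuous.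
  rewrite [X in X @ _](_ : _ = fun n => cell_sup V h st * pair_mean n
    (fun i j => \1_(base_cell V st.1) (x i) * \1_(base_cell V st.2) (x j))); last first.
    by apply/funext => n; rewrite pair_meanZ.
  apply: cvgMl_tmp; apply: (@pair_mean_prod_cvg _ _ _ _ _ 1); try exact: xm.
  by move=> j; rewrite indicE; case: (_ \in _); rewrite ?normr1 ?normr0.
move: Fcvg => /cvgrPdist_lt /(_ (e / 2)) -[|N _ NF]; first by lra.
exists N => // n /= Nn.
apply: (@le_trans _ _ (\sum_st pair_mean n (F st))).
  rewrite -pair_mean_sum; apply: ler_pair_mean => i j _.
  by rewrite -(step_supE V h k (x i, x j)); exact: (le_step_sup V hK).
have := NF n Nn; rewrite distrC; move: hk; rewrite distrC.
by move=> /ltr_distlCDr + /ltr_distlCDr; lra.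
Qed.

Theorem pair_mean_cvg_integral (h : S * S -> R) (K : R) :
  measurable_fun setT (h : borel S * borel S -> R) -> (forall z, `|h z| <= K) ->
  m2 (discontinuity_set h) = 0%E ->
  pair_mean n (fun i j => h (x i, x j)) @[n --> \oo] --> \int[m2]_z h z.
Proof.
move=> mh hK hD; apply/cvgrPdist_le => e e0.
have up := pair_mean_le_integral mh hK hD e0.
pose g z := - h z.
have mg : measurable_fun setT (g : borel S * borel S -> R).
  exact: (measurableT_comp (@oppr_measurable R setT) mh).
have gK z : `|g z| <= K by rewrite normrN.
have gD : m2 (discontinuity_set g) = 0%E.
  rewrite (_ : discontinuity_set g = discontinuity_set h)//.
  apply/seteqP; split => z /= hz hz'; apply: hz; first exact: cvgN.
  rewrite (_ : h = fun y => - g y); first exact: cvgN.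
  by apply/funext => y; rewrite opprK.
have lo := pair_mean_le_integral mg gK gD e0.
apply: filterS2 up lo => n.
have -> : pair_mean n (fun i j => g (x i, x j)) = - pair_mean n (fun i j => h (x i, x j)).
  by rewrite -mulN1r -pair_meanZ; congr pair_mean; do 2 apply/funext => ?; rewrite mulN1r.
have -> : \int[m2]_z g z = - \int[m2]_z h z.
  rewrite -mulN1r -RintegralZl//; first by apply: eq_Rintegral => z _; rewrite mulN1r.
  exact: (bounded_integrable m2fin).
by move=> ? ?; rewrite ler_norml; apply/andP; split; lra.
Qed.

End equidistribution.

(** * Measurability of the integrals against the product kernel *)

Section product_kernel.
Context {d d' : measure_display} {Omega : measurableType d} {S : measurableType d'}
  {R : realType}.
Variable mu : Omega -> probability S R.
Hypothesis mmu : forall A, measurable A -> measurable_fun setT (fun w => mu w A).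

(** The map [w |-> mu w \x mu w] is measurable for the Giry sigma-algebra, for which
    integration of a fixed nonnegative function is measurable. *)
Lemma measurable_integral_product (g : S * S -> \bar R) :
  measurable_fun setT g -> (forall z, (0 <= g z)%E) ->
  measurable_fun setT (fun w => (\int[mu w \x mu w]_z g z)%E).
Proof.
move=> mg g0.
have mmu' : measurable_fun setT (fun w => mu w : giry S R).
  by apply: measurable_giry_codensity => // B mB; exact: mmu.
have mm : measurable_fun setT (fun w => giry_prod ((mu w : giry S R), (mu w : giry S R))).
  apply: (measurableT_comp measurable_giry_prod).
  exact/measurable_fun_pair.
exact: (measurableT_comp (measurable_giry_int mg g0) mm).
Qed.

Lemma measurable_I2 (g : S * S -> R) :
  measurable_fun setT g -> measurable_fun setT (I2 mu g).
Proof.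
move=> mg; rewrite /I2 /Rintegral; apply: measurableT_comp => //.
have mEg : measurable_fun setT (EFin \o g) by exact/measurable_EFinP.
under eq_fun do rewrite integralE.
apply: emeasurable_funB; apply: measurable_integral_product => //.
- exact: measurable_funepos.
- exact: measurable_funeneg.
Qed.

End product_kernel.

(** * Jensen's inequality for powers *)

Section powR.
Context {R : realType} (p : R).
Hypothesis p1 : 1 <= p.

(** The graph of the power function lies above its tangent at [a]; this is Young's
    inequality between [a ^ (p - 1)] and [y].  Taking for [a] the mean of [y] and
    averaging gives Jensen's inequality for any mean. *)
Lemma powR_tangent (a y : R) : 0 <= a -> 0 <= y ->
  p * (a `^ (p - 1) * y) <= y `^ p + (p - 1) * a `^ p.
Proof.
move=> a0 y0; move: p1; rewrite le_eqVlt => /predU1P[<-|p1'].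
  by rewrite subrr powRr0 !mul1r mul0r addr0 powRr1.
have p0 : 0 < p by lra.
have := @conjugate_powR R (a `^ (p - 1)) y (p / (p - 1)) p (powR_ge0 _ _) y0.
have q0 : 0 < p / (p - 1) by rewrite divr_gt0 ?subr_gt0.
have pp : p - 1 != 0 by rewrite subr_eq0 gt_eqF.
have pp' : p != 0 by rewrite gt_eqF.
have pq : (p / (p - 1))^-1 + p^-1 = 1 by field; rewrite pp pp'.
move=> /(_ q0 p0 pq); rewrite -powRrM; have -> : (p - 1) * (p / (p - 1)) = p by field; exact: pp.
rewrite -(ler_pM2l p0) => /le_trans; apply.
rewrite le_eqVlt; apply/orP; left; apply/eqP; field.
by rewrite pp pp'.
Qed.

Lemma powR_le_self (y : R) : 0 <= y <= 1 -> y `^ p <= y.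
Proof.
move=> /andP[]; rewrite le_eqVlt => /predU1P[<- _|y0 y1].
  by rewrite powR0// gt_eqF// (lt_le_trans ltr01).
by rewrite ge1r_powR// y0.
Qed.

Lemma powR_add3 (a b c : R) : 0 <= a -> 0 <= b -> 0 <= c ->
  (a + b + c) `^ p <= 3 `^ p * (a `^ p + b `^ p + c `^ p).
Proof.
move=> a0 b0 c0; pose t := Num.max a (Num.max b c).
have t0 : 0 <= t by rewrite le_max a0.
have p0 : 0 <= p by exact: le_trans p1.
apply: (@le_trans _ _ ((3 * t) `^ p)).
  rewrite ge0_ler_powR ?nnegrE ?mulr_ge0 ?addr_ge0//.
  have : a <= t by rewrite le_max lexx.
  have : b <= t by rewrite !le_max lexx orbT.
  have : c <= t by rewrite !le_max lexx !orbT.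
  lra.
rewrite powRM// ler_wpM2l ?powR_ge0//.
have := powR_ge0 a p; have := powR_ge0 b p; have := powR_ge0 c p.
by rewrite /t /Num.max; case: ifP => _; [case: ifP => _|]; lra.
Qed.

Lemma cvg_powR0 (u : nat -> R) : (forall n, 0 <= u n) ->
  u n @[n --> \oo] --> 0 -> u n `^ p @[n --> \oo] --> 0.
Proof.
move=> u0 u_0; apply/cvgrPdist_le => e e0.
have m0 : 0 < Num.min 1 e by rewrite lt_min ltr01.
move/cvgrPdist_le : u_0 => /(_ _ m0); apply: filterS => n.
rewrite !sub0r !normrN !ger0_norm ?powR_ge0// le_min => /andP[u1 ue].
by apply: (le_trans (powR_le_self _) ue); rewrite u0.
Qed.

Lemma jensen_pair_mean (F : nat -> nat -> R) n : (1 < n)%N ->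
  `|pair_mean n F| `^ p <= pair_mean n (fun i j => `|F i j| `^ p).
Proof.
move=> n1; set a := pair_mean n (fun i j => `|F i j|).
have a0 : 0 <= a by exact: pair_mean_ge0.
apply: (@le_trans _ _ (a `^ p)).
  rewrite ge0_ler_powR ?nnegrE//; first exact: le_trans p1.
  exact: ler_norm_pair_mean.
have := @ler_pair_mean R n (fun i j => p * (a `^ (p - 1) * `|F i j|))
  (fun i j => `|F i j| `^ p + (p - 1) * a `^ p) _.
rewrite pair_meanD pair_mean_cst// !pair_meanZ -/a (mulrC _ a) mulr_powRB1//; last first.
  exact: lt_le_trans p1.
by move=> /(_ (fun _ _ _ => powR_tangent a0 (normr_ge0 _))); lra.
Qed.

Lemma jensen_Rintegral d (U : measurableType d) (m : {measure set U -> \bar R})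
    (f : U -> R) : m setT = 1%E -> m.-integrable setT (EFin \o f) ->
  m.-integrable setT (fun x => (`|f x| `^ p)%:E) ->
  `|\int[m]_x f x| `^ p <= \int[m]_x (`|f x| `^ p).
Proof.
move=> m1 fi fpi; set a := \int[m]_x `|f x|.
have a0 : 0 <= a by exact: Rintegral_ge0.
have p0 : 0 <= p by exact: le_trans p1.
have nfi := integrable_norm fi.
apply: (@le_trans _ _ (a `^ p)).
  by rewrite ge0_ler_powR ?nnegrE//; exact: le_normr_Rintegral.
have cst_i (c : R) : m.-integrable setT (EFin \o cst c).
  by apply: (@bounded_integrable _ _ _ m _ _ _ `|c|) => //; rewrite m1 ltry.
have ai : m.-integrable setT (EFin \o (fun x => a `^ (p - 1) * `|f x|)).
  exact: (integrableZl measurableT _ nfi).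
have pai : m.-integrable setT (EFin \o (fun x => p * (a `^ (p - 1) * `|f x|))).
  exact: (integrableZl measurableT _ ai).
have : \int[m]_x (p * (a `^ (p - 1) * `|f x|)) <=
    \int[m]_x (`|f x| `^ p + (cst ((p - 1) * a `^ p) : U -> R) x).
  apply: le_Rintegral => //.
  - exact: (integrableD measurableT fpi (cst_i _)).
  - by move=> x _; exact: powR_tangent.
rewrite RintegralD// Rintegral_cst// m1 mulr1 RintegralZl//.
rewrite RintegralZl// -/a (mulrC _ a) mulr_powRB1//; last exact: lt_le_trans p1.
lra.
Qed.

End powR.

(** * Truncation of the kernel *)

Section clamp.
Context {R : realType}.
Implicit Types K x y : R.

Definition clamp K x : R := Num.max (- K) (Num.min x K).

Lemma clamp_bounded K x : 0 <= K -> `|clamp K x| <= K.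
Proof.
move=> K0; rewrite ler_norml /clamp le_max lexx/= ge_max ge_min lexx orbT andbT.
lra.
Qed.

Lemma clamp_id K x : `|x| <= K -> clamp K x = x.
Proof.
by rewrite ler_norml /clamp => /andP[Kx xK]; rewrite (min_idPl xK) (max_idPr Kx).
Qed.

Lemma clamp_contract K x y : 0 <= K -> `|clamp K x - clamp K y| <= `|x - y|.
Proof.
move=> K0; have : `|x - y| <= `|x - y| by [].
rewrite {1}ler_norml => /andP[? ?]; rewrite ler_norml /clamp.
by case: (leP x K) => ?; case: (leP y K) => ?; rewrite /Num.max;
  repeat case: ifPn; rewrite -?leNgt => *; apply/andP; split; lra.
Qed.

Lemma clamp_defect K x : 0 <= K -> `|x - clamp K x| <= `|x|.
Proof.
move=> K0; have : `|x| <= `|x| by [].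
rewrite {1}ler_norml => /andP[? ?]; rewrite ler_norml /clamp.
by case: (leP x K) => ?; rewrite /Num.max;
  case: ifPn; rewrite -?leNgt => *; apply/andP; split; lra.
Qed.

Lemma discontinuity_clamp (S : topologicalType) (h : S -> R) K : 0 <= K ->
  discontinuity_set (clamp K \o h) `<=` discontinuity_set h.
Proof.
move=> K0 z /= hz hcont; apply: hz; apply/cvgrPdist_le => e e0.
move/cvgrPdist_le : hcont => /(_ e e0); apply: filterS => y.
by apply: le_trans; exact: clamp_contract.
Qed.

Lemma measurable_clamp d (U : measurableType d) (h : U -> R) K :
  measurable_fun setT h -> measurable_fun setT (clamp K \o h).
Proof.
move=> mh; apply: measurable_maxr => //; exact: measurable_minr.
Qed.

End clamp.

(** * Moments of pair averages and frequencies of visits *)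

Section pair_mean_integral.
Context {d : measure_display} {Omega : measurableType d} {R : realType}.
Variable P : probability Omega R.
Variable F : nat -> nat -> Omega -> R.
Hypothesis mF : forall i j, measurable_fun setT (F i j).

Lemma measurable_pair_mean n :
  measurable_fun setT (fun w => pair_mean n (fun i j => F i j w)).
Proof.
rewrite (_ : (fun w => _) = fun w => 'C(n, 2)%:R^-1 *
    \sum_(1 <= i < n.+1) \sum_(i.+1 <= j < n.+1) F i j w); last first.
  by apply/funext => w; rewrite -pair_sumE.
apply: measurable_funM => //; apply: measurable_sum => i; exact: measurable_sum.
Qed.

Lemma integral_pair_mean_le n (e : R) : (1 < n)%N ->
  (forall i j w, 0 <= F i j w) ->
  (forall i j, (1 <= i < j)%N -> (\int[P]_w (F i j w)%:E <= e%:E)%E) ->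
  (\int[P]_w (pair_mean n (fun i j => F i j w))%:E <= e%:E)%E.
Proof.
move=> n1 F0 Fe.
have mEF i j : measurable_fun setT (fun w => (F i j w)%:E) by exact/measurable_EFinP.
have EF0 i j w : (0 <= (F i j w)%:E)%E by rewrite lee_fin.
have mS i : measurable_fun setT (fun w => \sum_(i.+1 <= j < n.+1) (F i j w)%:E)%E.
  by apply: emeasurable_sum => j; exact: mEF.
have S0 i w : (0 <= \sum_(i.+1 <= j < n.+1) (F i j w)%:E)%E by exact: sume_ge0.
under eq_integral => w _.
  rewrite /pair_mean pair_sumE EFinM -sumEFin.
  under eq_bigr do rewrite -sumEFin.
  over.
rewrite ge0_integralZl//=; last 2 first.
- by apply: emeasurable_sum => i; exact: mS.
- by move=> w _; exact: sume_ge0.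
rewrite -[e in leRHS](pair_mean_cst e n1) /pair_mean EFinM lee_wpmul2l ?lee_fin ?invr_ge0//.
rewrite ge0_integral_sum// pair_sumE -sumEFin big_seq [leRHS]big_seq.
apply: lee_sum => i; rewrite mem_index_iota => /andP[i1 _].
rewrite ge0_integral_sum// -sumEFin big_seq [leRHS]big_seq.
by apply: lee_sum => j; rewrite mem_index_iota => /andP[ij _]; apply: Fe; rewrite i1.
Qed.

End pair_mean_integral.

Section empirical_frequencies.
Context {d : measure_display} {Omega : measurableType d} {R : realType}.
Variables (P : probability Omega R) (T : Omega -> Omega).
Hypothesis mT : measurable_fun setT T.
Hypothesis TP : forall A, measurable A -> P (T @^-1` A) = P A.
Context {d' : measure_display} {S : measurableType d'}.
Variables (X0 : Omega -> S) (mu : Omega -> probability S R).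
Hypothesis mX0 : measurable_fun setT X0.
Hypothesis muX0 : regular_cond_dist P (invariant_sets T) X0 mu.

Lemma measurable_cond_dist (A : set S) : measurable A ->
  measurable_fun setT (fun w => mu w A).
Proof.
move=> mA; have [_ iA _] := muX0 mA.
rewrite (_ : (fun w => mu w A) = EFin \o (fun w => fine (mu w A))).
  exact: measurable_int iA.
by apply/funext => w /=; rewrite fineK//; exact: fin_num_measure.
Qed.

(** The conditional distribution [mu w A] is invariant because level sets of a
    function measurable for the invariant sigma-algebra are invariant, so that it
    qualifies as the limit in [birkhoff]. *)
Lemma ae_frequency (A : set S) : measurable A ->
  {ae P, forall w, cesaro_cvg (fun i => \1_A (X0 (iter i T w))) (fine (mu w A))}.
Proof.
move=> mA; have [GA iA intA] := muX0 mA.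
have mXA : measurable (X0 @^-1` A) by rewrite -[X in measurable X]setTI; exact: mX0.
apply: (@birkhoff _ _ _ P T mT TP (\1_(X0 @^-1` A)) (fun w => fine (mu w A)) 1).
- exact: measurable_indic.
- by apply/measurable_EFinP; exact: measurable_int iA.
- by move=> w; rewrite indicE; case: (_ \in _); rewrite ?normr1 ?normr0.
- move=> w; rewrite ger0_norm ?fine_ge0// -lee_fin fineK ?probability_le1//.
  exact: fin_num_measure.
- move=> w; have [|_ ] := GA [set fine (mu w A)]; first exact: measurable_set1.
  move=> /seteqP[_ /(_ w)] /=; exact.
- by move=> E mE TE; rewrite /Rintegral -intA.
Qed.

End empirical_frequencies.

(** * Errors due to truncation *)

Lemma measurable_powR_abs (R : realType) d (U : measurableType d) (p : R) (f : U -> R) :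
  measurable_fun setT f -> measurable_fun setT (fun x => `|f x| `^ p).
Proof.
move=> mf; apply: (measurableT_comp (measurable_powR p)) => //.
exact: measurableT_comp.
Qed.

Section truncation.
Context {d d' : measure_display} {Omega : measurableType d} {S : measurableType d'}
  {R : realType}.
Variables (P : probability Omega R) (X : nat -> Omega -> S).
Hypothesis mX : forall i, measurable_fun setT (X i).
Variable mu : Omega -> probability S R.
Hypothesis mmu : forall A, measurable A -> measurable_fun setT (fun w => mu w A).
Variables (h : S * S -> R) (p : R).
Hypotheses (mh : measurable_fun setT h) (p1 : 1 <= p).

Let p0 : 0 <= p. Proof. exact: le_trans p1. Qed.

Let defect (K : R) (z : S * S) : R := `|h z - clamp K (h z)| `^ p.

Lemma defect_ge0 K z : 0 <= defect K z. Proof. exact: powR_ge0. Qed.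

Lemma defect_le K z : 0 <= K -> defect K z <= `|h z| `^ p.
Proof. by move=> K0; rewrite ge0_ler_powR ?nnegrE//; exact: clamp_defect. Qed.

Lemma defect_eq0 K z : `|h z| <= K -> defect K z = 0.
Proof.
move=> hK; rewrite /defect clamp_id// subrr normr0 powR0// gt_eqF//.
exact: lt_le_trans p1.
Qed.

Lemma measurable_defect K : measurable_fun setT (defect K).
Proof.
by apply: measurable_powR_abs; apply: measurable_funB => //; exact: measurable_clamp.
Qed.

Lemma defect_cvg0 z : defect k%:R z @[k --> \oo] --> 0.
Proof.
apply: cvg_near_cst; exists (Num.truncn `|h z|).+1 => // k /= hk.
apply: defect_eq0; apply: ltW; apply: (lt_le_trans (truncnS_gt _)).
by rewrite ler_nat.
Qed.

Lemma measurable_defect_pair K i j :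
  measurable_fun setT (fun w => defect K (X i w, X j w)).
Proof.
by apply: (measurableT_comp (measurable_defect K)); exact/measurable_fun_pair.
Qed.

(** The defect vanishes where [`|h| <= K] and is at most [`|h| `^ p] elsewhere, hence
    its mean is at most the tail of [`|h| `^ p] beyond [K `^ p]. *)
Lemma uniform_truncation (e : R) : 0 < e ->
  uniformly_integrable P [set ij : nat * nat | (1 <= ij.1 < ij.2)%N]
    (fun ij w => `|h (X ij.1 w, X ij.2 w)| `^ p) ->
  exists K0 : R, forall K, K0 <= K -> forall i j, (1 <= i < j)%N ->
    (\int[P]_w (defect K (X i w, X j w))%:E <= e%:E)%E.
Proof.
move=> e0 ui; have /ui : nbhs 0%E [set y : \bar R | (y < e%:E)%E].
  by apply: open_nbhs_nbhs; split; [exact: open_ereal_lt_ereal | rewrite /= lte_fin].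
move=> [c [_ tail]]; pose K0 := Num.max 1 (c + 1).
exists K0 => K K0K i j ij.
have [K1 cK] : 1 <= K /\ c + 1 <= K.
  by split; apply: le_trans K0K; rewrite le_max lexx ?orbT.
have K0' : 0 <= K by exact: le_trans K1.
(* [1 <= K] makes the tail level [K `^ p] at least [K], hence beyond [c] *)
have KKp : K <= K `^ p by exact: le1r_powR.
pose Z w := `|h (X i w, X j w)| `^ p.
have mZ : measurable_fun setT Z.
  by apply: measurable_powR_abs; apply: (measurableT_comp mh); exact/measurable_fun_pair.
have := tail (K `^ p) ltac:(lra) => /= tailK.
apply: (le_trans _ (ltW tailK)).
apply: (@le_trans _ _ (\int[P]_(w in [set w | (K `^ p < `|Z w|)%R]) `|Z w|%:E)%E); last first.
  by apply: ereal_sup_ubound; exists (i, j).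
have mD : measurable [set w | (K `^ p < `|Z w|)%R].
  have -> : [set w | (K `^ p < `|Z w|)%R] = (fun w => `|Z w|) @^-1` `]K `^ p, +oo[.
    by apply/seteqP; split => w /=; rewrite in_itv/= andbT.
  rewrite -[X in measurable X]setTI.
  have mnZ : measurable_fun setT (fun w => `|Z w|) by exact: measurableT_comp.
  exact: mnZ.
rewrite [leRHS]integral_mkcond; apply: ge0_le_integral => //.
- by move=> w _; rewrite lee_fin defect_ge0.
- by apply/measurable_EFinP; exact: measurable_defect_pair.
- apply/(measurable_restrictT _ mD); apply/measurable_EFinP; apply: measurable_funTS.
  exact: measurableT_comp.
- move=> w _; rewrite patchE; have [hK|hK] := leP `|h (X i w, X j w)| K.
    by rewrite defect_eq0//; case: ifP => _; rewrite lee_fin.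
  rewrite mem_set /=; last first.
    rewrite /Z ger0_norm ?powR_ge0// gt0_ltr_powR// ?nnegrE//.
    exact: lt_le_trans p1.
  by rewrite lee_fin [leRHS]ger0_norm ?powR_ge0//; exact: defect_le.
Qed.

Hypothesis hp : (\int[P]_w \int[mu w \x mu w]_z (`|h z| `^ p)%:E < +oo)%E.

Let mhp : measurable_fun setT (fun z => (`|h z| `^ p)%:E).
Proof. by apply/measurable_EFinP; exact: measurable_powR_abs. Qed.

Let mG : measurable_fun setT (fun w => (\int[mu w \x mu w]_z (`|h z| `^ p)%:E)%E).
Proof. by apply: measurable_integral_product => // z; rewrite lee_fin powR_ge0. Qed.

Let G0 w : (0 <= \int[mu w \x mu w]_z (`|h z| `^ p)%:E)%E.
Proof. by apply: integral_ge0 => z _; rewrite lee_fin powR_ge0. Qed.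

Let iG : P.-integrable setT (fun w => (\int[mu w \x mu w]_z (`|h z| `^ p)%:E)%E).
Proof.
by apply/integrableP; split => //; under eq_integral do rewrite gee0_abs//.
Qed.

Lemma ae_integrable_power :
  {ae P, forall w, (mu w \x mu w)%E.-integrable setT (fun z => (`|h z| `^ p)%:E)}.
Proof.
apply: filterS (integrable_ae measurableT iG) => w /(_ I) Gfin.
apply/integrableP; split => //.
under eq_integral do rewrite gee0_abs ?lee_fin ?powR_ge0//.
by move: Gfin; rewrite (ge0_fin_numE (G0 w)).
Qed.

(** Dominated convergence twice: on the square of [S] for almost every [w], with
    dominating function [`|h| `^ p], then on [Omega], with dominating function its
    integral. *)
Lemma truncated_integral_cvg0 :
  (\int[P]_w \int[mu w \x mu w]_z (defect k%:R z)%:E)%E @[k --> \oo] --> 0%E.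
Proof.
have mEd k : measurable_fun setT (fun z => (defect k%:R z)%:E).
  by apply/measurable_EFinP; exact: measurable_defect.
have Ed0 k w : (0 <= \int[mu w \x mu w]_z (defect k%:R z)%:E)%E.
  by apply: integral_ge0 => z _; rewrite lee_fin defect_ge0.
have [|||||_ _] := @dominated_convergence _ _ _ P _ measurableT
  (fun k w => (\int[mu w \x mu w]_z (defect k%:R z)%:E)%E) (cst 0%E)
  (fun w => (\int[mu w \x mu w]_z (`|h z| `^ p)%:E)%E).
- by move=> k; apply: measurable_integral_product => // z; rewrite lee_fin defect_ge0.
- exact: measurable_cst.
- apply: filterS ae_integrable_power => w iw _.
  have [|||||_ _] := @dominated_convergence _ _ _ (mu w \x mu w)%E _ measurableT
    (fun k z => (defect k%:R z)%:E) (cst 0%E) (fun z => (`|h z| `^ p)%:E).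
  + exact: mEd.
  + exact: measurable_cst.
  + by apply: aeW => z _; apply: cvg_EFin; [exact: nearW | exact: defect_cvg0].
  + exact: iw.
  + apply: aeW => z k _; rewrite gee0_abs ?lee_fin ?defect_ge0//; exact: defect_le.
  + by rewrite integral0.
- exact: iG.
- apply: aeW => w k _; rewrite gee0_abs//; apply: ge0_le_integral => //.
  + by move=> z _; rewrite lee_fin defect_ge0.
  + by move=> z _; rewrite lee_fin; exact: defect_le.
- by rewrite integral0.
Qed.

Lemma ae_I2_truncation (K : R) : 0 <= K -> {ae P, forall w,
  ((`|I2 mu h w - I2 mu (clamp K \o h) w| `^ p)%:E <=
   \int[mu w \x mu w]_z (defect K z)%:E)%E}.
Proof.
move=> K0; apply: filterS ae_integrable_power => w iw.
have m1 := product_probability_setT (mu w).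
have mfin : ((mu w \x mu w)%E setT < +oo)%E by rewrite [X in (X < _)%E]m1 ltry.
have ih : (mu w \x mu w)%E.-integrable setT (EFin \o h).
  have i1 : (mu w \x mu w)%E.-integrable setT (EFin \o cst 1).
    by apply: (@bounded_integrable _ _ _ _ mfin _ _ 1) => // z; rewrite normr1.
  apply: (le_integrable measurableT _ _ (integrableD measurableT i1 iw)).
    exact/measurable_EFinP.
  move=> z _ /=; rewrite lee_fin [leRHS]ger0_norm ?addr_ge0 ?powR_ge0//.
  have [h1|h1] := leP `|h z| 1; first by have := powR_ge0 `|h z| p; lra.
  by have := le1r_powR (ltW h1) p1; lra.
have iK : (mu w \x mu w)%E.-integrable setT (EFin \o (clamp K \o h)).
  apply: (@bounded_integrable _ _ _ _ mfin _ _ K) => //.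
    exact: measurable_clamp.
  by move=> z; exact: clamp_bounded.
have id : (mu w \x mu w)%E.-integrable setT (fun z => (defect K z)%:E).
  apply: (le_integrable measurableT _ _ iw).
    by apply/measurable_EFinP; exact: measurable_defect.
  move=> z _; rewrite !gee0_abs ?lee_fin ?powR_ge0//; exact: defect_le.
rewrite -(fineK (integrable_fin_num measurableT id)) lee_fin /I2 -RintegralB//.
apply: (jensen_Rintegral p1) => //.
exact: (integrableB measurableT ih iK).
Qed.

End truncation.

Lemma cvge_ge0_le (R : realType) (u : nat -> \bar R) :
  (forall n, (0 <= u n)%E) ->
  (forall e : R, 0 < e -> \forall n \near \oo, (u n <= e%:E)%E) ->
  u n @[n --> \oo] --> 0%E.
Proof.
move=> u0 ue.
have fin_u e n : (u n <= e%:E)%E -> u n \is a fin_num.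
  by move=> une; rewrite ge0_fin_numE// (le_lt_trans une) ?ltry.
apply/fine_cvgP; split; first by apply: filterS (ue 1 ltr01) => n /fin_u.
apply/cvgrPdist_le => e e0; apply: filterS (ue e e0) => n une.
rewrite sub0r normrN ger0_norm ?fine_ge0// -lee_fin fineK//.
exact: fin_u une.
Qed.

(** * Convergence for bounded kernels *)

Section bounded_kernel.
Context {d : measure_display} {Omega : measurableType d} {R : realType}.
Variables (P : probability Omega R) (T : Omega -> Omega) (S : pmetricType R).
Variables (X0 : Omega -> borel S) (mu : Omega -> probability (borel S) R) (p : R).
Hypothesis mT : measurable_fun setT T.
Hypothesis TP : forall A, measurable A -> P (T @^-1` A) = P A.
Hypothesis sepS : separable S.
Hypothesis mX0 : measurable_fun setT X0.
Hypothesis muX0 : regular_cond_dist P (invariant_sets T) X0 mu.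
Hypothesis p1 : 1 <= p.

Variables (g : S * S -> R) (K : R).
Hypothesis mg : measurable_fun setT (g : borel S * borel S -> R).
Hypothesis gK : forall z, `|g z| <= K.
Hypothesis gD : {ae P, forall w, (mu w \x mu w)%E (discontinuity_set g) = 0%E}.

Let X i w : borel S := X0 (iter i T w).
Let U n w := pair_mean n (fun i j => g (X i w, X j w)).

Lemma measurable_orbit i : measurable_fun setT (X i).
Proof.
apply: (measurableT_comp mX0); elim: i => [|i IHi]; first exact: measurable_id.
exact: (measurableT_comp mT IHi).
Qed.

(** There are only countably many cells, so that almost every [w] has the right
    visit frequencies in all of them simultaneously. *)
Lemma ae_pair_mean_cvg :
  {ae P, forall w, U n w @[n --> \oo] --> I2 mu g w}.
Proof.
have [V openV baseV] := separable_base sepS.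
have cells : {ae P, forall w, forall k (s : {ffun 'I_k -> bool}),
    cesaro_cvg (fun i => \1_(base_cell V s) (X i w)) (fine (mu w (base_cell V s)))}.
  apply: ae_foralln => k; apply: filter_forall => s.
  exact: (ae_frequency mT TP mX0 muX0 (measurable_base_cell openV s)).
apply: filterS2 gD cells => w Dw xw.
exact: (pair_mean_cvg_integral openV baseV xw mg gK Dw).
Qed.

Let K0 : 0 <= K. Proof. exact: le_trans (normr_ge0 _) (gK point). Qed.

Lemma I2_bounded w : `|I2 mu g w| <= K.
Proof.
have m1 := product_probability_setT (mu w).
have mfin : ((mu w \x mu w)%E setT < +oo)%E by rewrite [X in (X < _)%E]m1 ltry.
have ig := bounded_integrable mfin measurableT mg gK.
apply: (le_trans (le_normr_Rintegral measurableT ig)).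
have -> : K = \int[(mu w \x mu w)%E]_(z in setT) K.
  by rewrite Rintegral_cst// [X in fine X]m1 mulr1.
apply: le_Rintegral => //; first exact: integrable_norm.
by apply: (@bounded_integrable _ _ _ _ mfin _ _ K) => // z; rewrite ger0_norm.
Qed.

Lemma Lp_pair_mean_cvg (e : R) : 0 < e -> \forall n \near \oo,
  (\int[P]_w (`|U n w - I2 mu g w| `^ p)%:E <= e%:E)%E.
Proof.
move=> e0.
have Pfin : (P setT < +oo)%E by rewrite [X in (X < _)%E]probability_setT ltry.
have mI : measurable_fun setT (I2 mu g).
  exact: (measurable_I2 (measurable_cond_dist muX0) mg).
have mD n : measurable_fun setT (fun w => `|U n w - I2 mu g w| `^ p).
  apply: measurable_powR_abs; apply: measurable_funB => //.
  apply: measurable_pair_mean => i j; apply: (measurableT_comp mg).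
  by apply/measurable_fun_pair; exact: measurable_orbit.
have bD n w : `| `|U n w - I2 mu g w| `^ p| <= (K + K) `^ p.
  rewrite ger0_norm ?powR_ge0// ge0_ler_powR ?nnegrE ?addr_ge0//.
    exact: le_trans p1.
  apply: (le_trans (ler_normB _ _)); apply: lerD; last exact: I2_bounded.
  exact: pair_mean_bounded.
have : \int[P]_w (`|U n w - I2 mu g w| `^ p) @[n --> \oo] --> \int[P]_w (cst 0 w).
  apply: (bounded_convergence Pfin measurableT mD _ bD) => //.
  apply: filterS ae_pair_mean_cvg => w Uw _; apply: (cvg_powR0 p1) => //.
  by apply/norm_cvg0P; apply/subr_cvg0.
rewrite Rintegral_cst// mul0r => /cvgrPdist_le/(_ e e0); apply: filterS => n.
rewrite sub0r normrN => De.
have iD := bounded_integrable Pfin measurableT (mD n) (bD n).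
rewrite -(fineK (integrable_fin_num measurableT iD)) lee_fin.
exact: le_trans (ler_norm _) De.
Qed.

End bounded_kernel.

(** * Convergence of the U-statistic *)

(** The error is split into the truncation error of the U-statistic, the error for
    the truncated kernel and the truncation error of the limit, the [p]-th moments
    of which are made smaller than [del]. *)
Theorem theorem1p3 (R : realType) (d : measure_display)
    (Omega : measurableType d) (P : probability Omega R)
    (T Tinv : Omega -> Omega) (S : pmetricType R) (X0 : Omega -> borel S)
    (mu : Omega -> probability (borel S) R) (h : S * S -> R) (p : R)
    (X := orbit_process T Tinv X0) :
  mp_automorphism P T Tinv ->
  separable S ->
  measurable_fun setT X0 ->
  regular_cond_dist P (invariant_sets T) X0 mu ->
  1 <= p ->
  measurable_fun setT (h : borel S * borel S -> R) ->
  uniformly_integrable P [set ij : nat * nat | (1 <= ij.1 < ij.2)%N]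
    (fun ij w => `|h (X ij.1 w, X ij.2 w)| `^ p) ->
  {ae P, forall w, I2 mu (\1_(discontinuity_set h)) w = 0} ->
  (\int[P]_w \int[mu w \x mu w]_z (`|h z| `^ p)%:E < +oo)%E ->
  (fun n => 'N[P]_(p%:E)[EFin \o (fun w => ustat2 X h n w - I2 mu h w)%R]%E)
    @ \oo --> 0%E.
Proof.
move=> [_ _ mT _ TP] sepS mX0 muX0 p1 mh ui hD hp.
have p0 : 0 < p by exact: lt_le_trans p1.
have mmu := measurable_cond_dist muX0.
pose Y i w : borel S := X0 (iter i T w).
have mY i : measurable_fun setT (Y i) by exact: measurable_orbit.
have [V openV baseV] := separable_base sepS.
pose U f n w := pair_mean n (fun i j => f (Y i w, Y j w)) : R.
pose D n w := `|U h n w - I2 mu h w| `^ p.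
have mI f : measurable_fun setT (f : borel S * borel S -> R) ->
  measurable_fun setT (I2 mu f) by exact: measurable_I2.
have mU f n : measurable_fun setT (f : borel S * borel S -> R) ->
    measurable_fun setT (U f n).
  move=> mf; apply: measurable_pair_mean => i j.
  by apply: (measurableT_comp mf); exact/measurable_fun_pair.
have D_cvg (e : R) : 0 < e -> \forall n \near \oo, (\int[P]_w (D n w)%:E <= e%:E)%E.
  (* three terms, and the factor [3 `^ p] of [powR_add3] *)
  move=> e0; pose del := e / (3 * 3 `^ p).
  have del0 : 0 < del by rewrite divr_gt0// mulr_gt0// powR_gt0.
  have [K0 UK] := uniform_truncation mY mh p1 del0 ui.
  have [k [kK0 Ik]] : exists k : nat, K0 <= k%:R /\
    (\int[P]_w \int[mu w \x mu w]_z (`|h z - clamp k%:R (h z)| `^ p)%:E <= del%:E)%E.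
    have : nbhs 0%E [set y : \bar R | (y < del%:E)%E].
      by apply: open_nbhs_nbhs; split; [exact: open_ereal_lt_ereal | rewrite /= lte_fin].
    move=> /(truncated_integral_cvg0 mmu mh p1 hp) [N _ NI].
    exists (maxn N (Num.truncn K0).+1); split.
      apply: (le_trans (ltW (truncnS_gt K0))); rewrite ler_nat; exact: leq_maxr.
    by apply: ltW; apply: NI => /=; exact: leq_maxl.
  pose hk : S * S -> R := clamp k%:R \o h.
  have mhk : measurable_fun setT (hk : borel S * borel S -> R) by exact: measurable_clamp.
  have hkD : {ae P, forall w, (mu w \x mu w)%E (discontinuity_set hk) = 0%E}.
    have mDh := measurable_discontinuity openV baseV h.
    have mDhk := measurable_discontinuity openV baseV hk.
    apply: filterS hD => w; rewrite /I2 /Rintegral integral_indic// setIT => hDw.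
    apply: (subset_measure0 mDhk mDh); first exact: discontinuity_clamp.
    have m1 := product_probability_setT (mu w).
    rewrite -[LHS]fineK ?hDw//; apply/fin_numPlt.
    rewrite (lt_le_trans _ (measure_ge0 _ _)) ?ltNyr//=.
    by apply: le_lt_trans (_ : (1 < +oo)%E); [rewrite -m1 le_measure ?inE | exact: ltry].
  have hkB z : `|hk z| <= k%:R by exact: clamp_bounded.
  have Bcvg := Lp_pair_mean_cvg mT TP sepS mX0 muX0 p1 mhk hkB hkD del0.
  have n2 : \forall n \near \oo, (1 < n)%N by exists 2.
  apply: filterS2 n2 Bcvg => n n1 Bn.
  pose F i j w := `|h (Y i w, Y j w) - hk (Y i w, Y j w)| `^ p.
  pose A w := pair_mean n (fun i j => F i j w).
  pose B w := `|U hk n w - I2 mu hk w| `^ p.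
  pose C w := (\int[mu w \x mu w]_z (`|h z - hk z| `^ p)%:E)%E.
  have mDf : measurable_fun setT ((fun z => `|h z - hk z| `^ p) : borel S * borel S -> R)
    by exact: (measurable_defect p mh).
  have mF i j : measurable_fun setT (F i j).
    by apply: (measurableT_comp mDf); exact/measurable_fun_pair.
  have F0 i j w : 0 <= F i j w by exact: powR_ge0.
  have mA : measurable_fun setT A by exact: measurable_pair_mean.
  have mB : measurable_fun setT B.
    by apply: measurable_powR_abs; apply: measurable_funB; [exact: mU | exact: mI].
  have mC : measurable_fun setT C.
    by apply: measurable_integral_product => //; exact/measurable_EFinP.
  have A0 w : 0 <= A w.
    by apply: pair_mean_ge0 => i j; exact: F0.
  have C0 w : (0 <= C w)%E by apply: integral_ge0 => z _; rewrite lee_fin powR_ge0.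
  have IA : (\int[P]_w (A w)%:E <= del%:E)%E.
    have FU i j : (1 <= i < j)%N -> (\int[P]_w (F i j w)%:E <= del%:E)%E by exact: UK.
    exact: (@integral_pair_mean_le _ _ _ P F mF n del n1 F0 FU).
  pose ABC w := ((A w)%:E + (B w)%:E + C w)%E.
  have mAB : measurable_fun setT (fun w => (A w)%:E + (B w)%:E)%E.
    by apply/measurable_EFinP; exact: measurable_funD.
  have mABC : measurable_fun setT ABC by exact: emeasurable_funD.
  have ABC0 w : (0 <= ABC w)%E.
    by apply: adde_ge0 => //; apply: adde_ge0; rewrite lee_fin ?powR_ge0.
  have DABC : {ae P, forall w, setT w ->
      ((D n w)%:E <= (3 `^ p)%:E * ABC w)%E}.
    have := ae_I2_truncation mmu mh p1 hp (ler0n R k).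
    apply: filterS => w Iw _.
    apply: (@le_trans _ _ (3 `^ p * (A w + B w + `|I2 mu h w - I2 mu hk w| `^ p))%:E).
      rewrite lee_fin.
      have UA : `|U h n w - U hk n w| `^ p <= A w.
        have -> : U h n w - U hk n w =
            pair_mean n (fun i j => h (Y i w, Y j w) - hk (Y i w, Y j w)).
          rewrite pair_meanD; congr (_ + _); rewrite -mulN1r -pair_meanZ.
          by congr pair_mean; do 2 apply/funext => ?; rewrite mulN1r.
        exact: jensen_pair_mean.
      apply: (@le_trans _ _ ((`|U h n w - U hk n w| + `|U hk n w - I2 mu hk w| +
          `|I2 mu h w - I2 mu hk w|) `^ p)).
        rewrite ge0_ler_powR ?nnegrE ?addr_ge0//; first exact: ltW.
        rewrite (distrC (I2 mu h w)).
        rewrite -[X in `|X| <= _](_ : (U h n w - U hk n w) + (U hk n w - I2 mu hk w) +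
          (I2 mu hk w - I2 mu h w) = _); last by lra.
        by apply: (le_trans (ler_normD _ _)); rewrite lerD2r ler_normD.
      apply: (le_trans (powR_add3 p1 _ _ _)) => //.
      by rewrite ler_wpM2l ?powR_ge0// !lerD2r.
    rewrite EFinM lee_wpmul2l ?lee_fin ?powR_ge0// !EFinD leeD2l//.
  apply: (le_trans (ae_ge0_le_integral measurableT _ _ _ _ DABC)).
  - by move=> w _; rewrite lee_fin powR_ge0.
  - apply/measurable_EFinP; apply: measurable_powR_abs.
    by apply: measurable_funB; [exact: mU | exact: mI].
  - by move=> w _; rewrite mule_ge0 ?lee_fin ?powR_ge0.
  - exact: (measurable_funeM _ mABC).
  rewrite ge0_integralZl//.
  rewrite ge0_integralD//; last by move=> w _; rewrite adde_ge0 ?lee_fin ?powR_ge0.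
  rewrite ge0_integralD//; last 4 first.
  - by move=> w _; rewrite lee_fin.
  - exact/measurable_EFinP.
  - by move=> w _; rewrite lee_fin powR_ge0.
  - exact/measurable_EFinP.
  have -> : e%:E = ((3 `^ p)%:E * (del%:E + del%:E + del%:E))%E.
    rewrite -!EFinD -EFinM; congr EFin; rewrite /del; field.
    by rewrite gt_eqF// powR_gt0.
  by rewrite lee_wpmul2l ?lee_fin ?powR_ge0// !leeD.
apply: cvge_ge0_le => [n|e e0]; first exact: Lnorm_ge0.
apply: filterS (D_cvg (e `^ p) (powR_gt0 _ e0)) => n Dn.
rewrite unlock /Lnorm.
have -> : e = (e `^ p) `^ p^-1 by rewrite -powRrM mulfV ?gt_eqF// powRr1// ltW.
rewrite -poweR_EFin; apply: gt0_ler_poweR.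
- by rewrite invr_ge0 ltW.
- by rewrite in_itv/= leey andbT; apply: integral_ge0 => w _; rewrite lee_fin powR_ge0.
- by rewrite in_itv/= leey andbT lee_fin powR_ge0.
- exact: Dn.
Qed.
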